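(* Given the data-dictionary $\mathcal{D}_{N_\mathrm{d}}=\{u_k,p_k,x_k\}_{k=1}^{N_\mathrm{d}}$ measured from the LPV system $x_{k+1}=A(p_k)x_k+B(p_k)u_k$ (with affine dependence $A(p)=A_0+\sum_{i=1}^{n_\mathrm{p}}p_iA_i$, $B(p)=B_0+\sum_{i=1}^{n_\mathrm{p}}p_iB_i$) and satisfying the persistency of excitation condition that $D_\mathrm{p}:=\begin{bmatrix} X^\top & (X^\mathrm{p})^\top & U^\top & (U^\mathrm{p})^\top\end{bmatrix}^\top$ has full row rank $(1+n_\mathrm{p})(n_\mathrm{x}+n_\mathrm{u})$. For an LPV controller $u_k=K(p_k)x_k$ with $K(p)=K_0+\sum_{i=1}^{n_\mathrm{p}}p_iK_i$ and $\bar{K}=\begin{bmatrix}K_1 & \cdots & K_{n_\mathrm{p}}\end{bmatrix}$, the closed-loop system $x_{k+1}=(A(p_k)+B(p_k)K(p_k))x_k$ is represented equivalently as \[ x_{k+1}=X_+\mathcal{V}\begin{bmatrix} x_k\\ p_k\otimes x_k\\ p_k\otimes p_k\otimes x_k\end{bmatrix}, \] where $\mathcal{V}\in\mathbb{R}^{(N_\mathrm{d}-1)\times n_\mathrm{x}(1+n_\mathrm{p}+n_\mathrm{p}^2)}$ is any matrix that satisfies \[ \mathcal{M}_\mathrm{CL}:=\begin{bmatrix} I_{n_\mathrm{x}} & 0 & 0\\ 0 & I_{n_\mathrm{p}}\otimes I_{n_\mathrm{x}} & 0\\ K_0 & \bar{K} & 0\\ 0 & I_{n_\mathrm{p}}\otimes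 K_0 & I_{n_\mathrm{p}}\otimes\bar{K}\end{bmatrix}=\begin{bmatrix} X\\ X^\mathrm{p}\\ U\\ U^\mathrm{p}\end{bmatrix}\mathcal{V}. \]
   Context: Discrete-time LPV system $x_{k+1}=A(p_k)x_k+B(p_k)u_k$, $y_k=x_k$, with $x_k\in\mathbb{R}^{n_\mathrm{x}}$, $u_k\in\mathbb{R}^{n_\mathrm{u}}$, $p_k\in\mathbb{P}\subset\mathbb{R}^{n_\mathrm{p}}$ ($\mathbb{P}$ compact and convex), and $A,B$ affine in $p$. From the measured data $\mathcal{D}_{N_\mathrm{d}}=\{u^\mathrm{d}_k,p^\mathrm{d}_k,x^\mathrm{d}_k\}_{k=1}^{N_\mathrm{d}}$ the data matrices are $U=\begin{bmatrix}u^\mathrm{d}_1 & \cdots & u^\mathrm{d}_{N_\mathrm{d}-1}\end{bmatrix}$, $U^\mathrm{p}=\begin{bmatrix}p^\mathrm{d}_1\otimes u^\mathrm{d}_1 & \cdots & p^\mathrm{d}_{N_\mathrm{d}-1}\otimes u^\mathrm{d}_{N_\mathrm{d}-1}\end{bmatrix}$, $X=\begin{bmatrix}x^\mathrm{d}_1 & \cdots & x^\mathrm{d}_{N_\mathrm{d}-1}\end{bmatrix}$, $X^\mathrm{p}=\begin{bmatrix}p^\mathrm{d}_1\otimes x^\mathrm{d}_1 & \cdots & p^\mathrm{d}_{N_\mathrm{d}-1}\otimes x^\mathrm{d}_{N_\mathrm{d}-1}\end{bmatrix}$, $X_+=\begin{bmatrix}x^\mathrm{d}_2 & \cdots & x^\mathrm{d}_{N_\mathrm{d}}\end{bmatrix}$;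 $\otimes$ is the Kronecker product. *)

(* Defs.v *)
(* Kronecker product = tensmx (A *t B) from mathcomp real_closed mxtens,
   with the standard convention (A *t B) (i*p+k) (j*q+l) = A i j * B k l. *)
From HB Require Import structures.
From mathcomp Require Import all_boot all_order all_algebra.
From mathcomp Require Export mxtens.
Set Implicit Arguments. Unset Strict Implicit. Unset Printing Implicit Defensive.
Import Order.TTheory GRing.Theory Num.Theory.
Local Open Scope ring_scope.

Section Defs.
Variable R : realFieldType.

(* affine parameter dependence  M(p) = M0 + sum_i p_i M_i  (M i is M_{i+1}) *)
Definition affmx (np m n : nat) (M0 : 'M[R]_(m, n)) (M : 'I_np -> 'M[R]_(m, n))
  (p : 'cV[R]_np) : 'M[R]_(m, n) :=
  M0 + \sum_(i < np) p i 0 *: M i.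

(* Kbar = [K_1 ... K_np] : column index i*nx + j is column j of K_{i+1} *)
Definition Kbar (np nu nx : nat) (K : 'I_np -> 'M[R]_(nu, nx)) : 'M[R]_(nu, np * nx) :=
  \matrix_(r < nu, c < np * nx) K (mxtens_unindex c).1 r (mxtens_unindex c).2.

(* data matrices built from samples indexed 1..Nd; column j is sample j+1 *)
Definition dataU (nu Nd : nat) (ud : nat -> 'cV[R]_nu) : 'M[R]_(nu, Nd.-1) :=
  \matrix_(i < nu, j < Nd.-1) ud j.+1 i 0.
Definition dataX (nx Nd : nat) (xd : nat -> 'cV[R]_nx) : 'M[R]_(nx, Nd.-1) :=
  \matrix_(i < nx, j < Nd.-1) xd j.+1 i 0.
Definition dataXplus (nx Nd : nat) (xd : nat -> 'cV[R]_nx) : 'M[R]_(nx, Nd.-1) :=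
  \matrix_(i < nx, j < Nd.-1) xd j.+2 i 0.
Definition dataUp (np nu Nd : nat) (pd : nat -> 'cV[R]_np) (ud : nat -> 'cV[R]_nu)
  : 'M[R]_(np * nu, Nd.-1) :=
  \matrix_(i < np * nu, j < Nd.-1) (pd j.+1 *t ud j.+1) i 0.
Definition dataXp (np nx Nd : nat) (pd : nat -> 'cV[R]_np) (xd : nat -> 'cV[R]_nx)
  : 'M[R]_(np * nx, Nd.-1) :=
  \matrix_(i < np * nx, j < Nd.-1) (pd j.+1 *t xd j.+1) i 0.

Definition dataDp (np nx nu Nd : nat) (pd : nat -> 'cV[R]_np) (xd : nat -> 'cV[R]_nx)
  (ud : nat -> 'cV[R]_nu) : 'M[R]_(nx + (np * nx + (nu + np * nu)), Nd.-1) :=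
  col_mx (dataX Nd xd) (col_mx (dataXp Nd pd xd) (col_mx (dataU Nd ud) (dataUp Nd pd ud))).

Definition row3 (m n1 n2 n3 : nat) (A : 'M[R]_(m, n1)) (B : 'M[R]_(m, n2))
  (C : 'M[R]_(m, n3)) : 'M[R]_(m, n1 + (n2 + n3)) := row_mx A (row_mx B C).

Definition MCL (np nx nu : nat) (K0 : 'M[R]_(nu, nx)) (K : 'I_np -> 'M[R]_(nu, nx))
  : 'M[R]_(nx + (np * nx + (nu + np * nu)), nx + (np * nx + np * (np * nx))) :=
  col_mx (row3 (1%:M : 'M_nx) 0 0)
 (col_mx (row3 0 ((1%:M : 'M_np) *t (1%:M : 'M_nx)) 0)
 (col_mx (row3 K0 (Kbar K) 0)
         (row3 0 ((1%:M : 'M_np) *t K0) ((1%:M : 'M_np) *t Kbar K)))).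

End Defs.

(* Main.v *)
(** Proof idea: the regressor built from (x, p ⊗ x, u, p ⊗ u) linearises the
    bilinear LPV dynamics, x+ = [A0 Ā B0 B̄] (x; p⊗x; u; p⊗u).  Applied to every
    sample this gives X+ = [A0 Ā B0 B̄] D_p, while M_CL maps (x; p⊗x; p⊗p⊗x) to
    the regressor of the closed-loop input u = K(p) x.  Hence
    X+ V (x; p⊗x; p⊗p⊗x) = [A0 Ā B0 B̄] M_CL (x; p⊗x; p⊗p⊗x)
                         = A(p) x + B(p) K(p) x. *)
Require Import Defs.
From HB Require Import structures.
From mathcomp Require Import all_boot all_order all_algebra.
From mathcomp Require Import mxtens.
Set Implicit Arguments. Unset Strict Implicit. Unset Printing Implicit Defensive.
Import Order.TTheory GRing.Theory Num.Theory.
Local Open Scope ring_scope.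

Lemma tensmxDr (R : pzRingType) m n p q (A : 'M[R]_(m, n)) (B C : 'M[R]_(p, q)) :
  A *t (B + C) = A *t B + A *t C.
Proof. by apply/matrixP => i j; rewrite !mxE mulrDr. Qed.

Lemma col_mulmx (R : pzSemiRingType) m n k (A : 'M[R]_(m, n)) (B : 'M[R]_(n, k)) j :
  col j (A *m B) = A *m col j B.
Proof. by rewrite !colE mulmxA. Qed.

Lemma matrix_colP (T : Type) m n (A B : 'M[T]_(m, n)) :
  (forall j, col j A = col j B) -> A = B.
Proof.
move=> eq_col; apply/matrixP => i j.
by move/matrixP: (eq_col j) => /(_ i 0); rewrite !mxE.
Qed.

Section LPVDataRepresentation.
Variable R : realFieldType.

Lemma mulmx_Kbar_tens np m n (M : 'I_np -> 'M[R]_(m, n))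
    (p : 'cV[R]_np) (y : 'cV[R]_n) :
  Kbar M *m (p *t y) = \sum_(i < np) p i 0 *: (M i *m y).
Proof.
apply/matrixP => r c; rewrite !mxE summxE.
rewrite (reindex (@mxtens_index np n)) /=; last first.
  by exists (@mxtens_unindex np n) => k _; rewrite (mxtens_indexK, mxtens_unindexK).
symmetry; under eq_bigr do rewrite !mxE big_distrr.
rewrite pair_bigA /=; apply: eq_bigr => [[i j]] _ /=.
rewrite !mxE !mxtens_indexK /= mulrCA (ord1 c).
by congr (_ * (p i _ * y j _)); apply: val_inj.
Qed.

Lemma affmx_mul_tens np m n (M0 : 'M[R]_(m, n)) (M : 'I_np -> 'M[R]_(m, n))
    (p : 'cV[R]_np) (y : 'cV[R]_n) :
  affmx M0 M p *m y = row_mx M0 (Kbar M) *m col_mx y (p *t y).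
Proof.
rewrite mul_row_col mulmx_Kbar_tens /affmx mulmxDl mulmx_suml.
by congr (_ + _); apply: eq_bigr => i _; rewrite scalemxAl.
Qed.

Definition lpv_regressor np nx nu (p : 'cV[R]_np) (x : 'cV[R]_nx) (u : 'cV[R]_nu)
    : 'cV[R]_(nx + (np * nx + (nu + np * nu))) :=
  col_mx x (col_mx (p *t x) (col_mx u (p *t u))).

Definition lpv_coefmx np nx nu (A0 : 'M[R]_nx) (A : 'I_np -> 'M[R]_nx)
    (B0 : 'M[R]_(nx, nu)) (B : 'I_np -> 'M[R]_(nx, nu))
    : 'M[R]_(nx, nx + (np * nx + (nu + np * nu))) :=
  row_mx A0 (row_mx (Kbar A) (row_mx B0 (Kbar B))).

Lemma lpv_coefmx_regressor np nx nu (A0 : 'M[R]_nx) (A : 'I_np -> 'M[R]_nx)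
    (B0 : 'M[R]_(nx, nu)) (B : 'I_np -> 'M[R]_(nx, nu))
    (p : 'cV[R]_np) (x : 'cV[R]_nx) (u : 'cV[R]_nu) :
  lpv_coefmx A0 A B0 B *m lpv_regressor p x u
  = affmx A0 A p *m x + affmx B0 B p *m u.
Proof. by rewrite !affmx_mul_tens !mul_row_col !addrA. Qed.

Lemma col_dataDp np nx nu Nd (pd : nat -> 'cV[R]_np) (xd : nat -> 'cV[R]_nx)
    (ud : nat -> 'cV[R]_nu) (j : 'I_Nd.-1) :
  col j (dataDp Nd pd xd ud) = lpv_regressor (pd j.+1) (xd j.+1) (ud j.+1).
Proof.
rewrite /dataDp !col_col_mx.
by congr (col_mx _ (col_mx _ (col_mx _ _))); apply/matrixP => a b;
  rewrite !mxE (ord1 b).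
Qed.

Lemma col_dataXplus nx Nd (xd : nat -> 'cV[R]_nx) (j : 'I_Nd.-1) :
  col j (dataXplus Nd xd) = xd j.+2.
Proof. by apply/matrixP => a b; rewrite !mxE (ord1 b). Qed.

Lemma dataXplus_factor np nx nu Nd (A0 : 'M[R]_nx) (A : 'I_np -> 'M[R]_nx)
    (B0 : 'M[R]_(nx, nu)) (B : 'I_np -> 'M[R]_(nx, nu))
    (pd : nat -> 'cV[R]_np) (xd : nat -> 'cV[R]_nx) (ud : nat -> 'cV[R]_nu) :
  (forall k, (1 <= k < Nd)%N ->
     xd k.+1 = affmx A0 A (pd k) *m xd k + affmx B0 B (pd k) *m ud k) ->
  dataXplus Nd xd = lpv_coefmx A0 A B0 B *m dataDp Nd pd xd ud.
Proof.
move=> sys; apply: matrix_colP => j.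
by rewrite col_mulmx col_dataDp col_dataXplus lpv_coefmx_regressor sys //
  -ltn_predRL ltn_ord.
Qed.

Lemma MCL_mul_lift np nx nu (K0 : 'M[R]_(nu, nx)) (K : 'I_np -> 'M[R]_(nu, nx))
    (p : 'cV[R]_np) (x : 'cV[R]_nx) :
  MCL K0 K *m col_mx x (col_mx (p *t x) (p *t (p *t x)))
  = lpv_regressor p x (affmx K0 K p *m x).
Proof.
rewrite /MCL /row3 !mul_col_mx !mul_row_col !mul0mx !mul1mx.
rewrite !(@tensmx_mul R _ _ _ _ 1 1) !mul1mx.
by rewrite !addr0 !add0r affmx_mul_tens mul_row_col /lpv_regressor tensmxDr.
Qed.

End LPVDataRepresentation.

Theorem theorem1 (R : realFieldType) (nx nu np Nd : nat)
  (P : 'cV[R]_np -> Prop)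
  (A0 : 'M[R]_nx) (A : 'I_np -> 'M[R]_nx)
  (B0 : 'M[R]_(nx, nu)) (B : 'I_np -> 'M[R]_(nx, nu))
  (ud : nat -> 'cV[R]_nu) (pd : nat -> 'cV[R]_np) (xd : nat -> 'cV[R]_nx)
  (Hp : forall k, (1 <= k <= Nd)%N -> P (pd k))
  (Hsys : forall k, (1 <= k < Nd)%N ->
     xd k.+1 = affmx A0 A (pd k) *m xd k + affmx B0 B (pd k) *m ud k)
  (Hpe : \rank (dataDp Nd pd xd ud) = ((1 + np) * (nx + nu))%N)
  (K0 : 'M[R]_(nu, nx)) (K : 'I_np -> 'M[R]_(nu, nx))
  (V : 'M[R]_(Nd.-1, nx + (np * nx + np * (np * nx))))
  (HV : MCL K0 K = dataDp Nd pd xd ud *m V) :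
  forall (p : 'cV[R]_np) (x : 'cV[R]_nx), P p ->
    (affmx A0 A p + affmx B0 B p *m affmx K0 K p) *m x
    = dataXplus Nd xd *m V *m col_mx x (col_mx (p *t x) (p *t (p *t x))).
Proof.
(* Persistency of excitation only guarantees that some V solving HV exists;
   the representation holds for every solution. *)
move=> p x _.
rewrite (dataXplus_factor Hsys) -[_ *m V]mulmxA -HV -mulmxA MCL_mul_lift.
by rewrite lpv_coefmx_regressor mulmxDl mulmxA.
Qed.
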